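(* There is no Eisenstein lattice equable rhombus; that is, no rhombus with all its vertices in $\mathbb{Z}[\omega]$ is equable.
   Context: A planar polygon is equable if its perimeter equals its area. The Eisenstein lattice is $\mathbb{Z}[\omega]\subset\mathbb{C}$, where $\omega=-\frac12+i\frac{\sqrt3}{2}$. *)

(* Defs.v *)
From mathcomp Require Import all_boot all_order all_algebra.
From mathcomp Require Import complex.
From mathcomp Require Import all_classical all_reals all_analysis.

Set Implicit Arguments.
Unset Strict Implicit.
Unset Printing Implicit Defensive.

Import Order.TTheory GRing.Theory Num.Theory.

Local Open Scope classical_set_scope.
Local Open Scope ring_scope.
Local Open Scope complex_scope.

Definition omega (R : realType) : R[i] := (- (1 / 2)) +i* (Num.sqrt 3 / 2).

Definition eisenstein (R : realType) : set R[i] :=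
  [set z | exists a b : int, z = a%:~R + b%:~R * omega R].

(* `normc` is the complex modulus with values in R (the norm `|z| of R[i]
   takes its values in R[i]). *)
Definition edge_length (R : realType) (z w : R[i]) : R :=
  ComplexField.Normc.normc (w - z).

(* A polygon is given by the list of its vertices in cyclic order; zipping with
   `rot 1` pairs each vertex with the next one, the last with the first. *)
Definition perimeter (R : realType) (s : seq R[i]) : R :=
  \sum_(e <- zip s (rot 1 s)) edge_length e.1 e.2.

Definition planar_area (R : realType) (X : set R[i]) : \bar R :=
  (lebesgue_measure \x lebesgue_measure)%E
    [set p : measurableTypeR R * measurableTypeR R | X ((p.1 : R) +i* (p.2 : R))].

(* The region bounded by a convex polygon is the convex hull of its vertices.
   `Rcomplex R` is R[i] seen as an R-module (R[i] itself is only a ring). *)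
Definition convex_polygon_region (R : realType) (s : seq R[i]) : set R[i] :=
  smallest (@convex_set R (Rcomplex R)) [set` s].

(* For convex polygons, in particular for rhombi. *)
Definition equable (R : realType) (s : seq R[i]) : Prop :=
  planar_area (convex_polygon_region s) = (perimeter s)%:E.

(* Four equal sides and distinct vertices: in the plane, this forces a, b, c, d
   to be the consecutive vertices of a nondegenerate (hence convex)
   parallelogram. Without distinctness, folded figures (a = c or b = d) would
   be allowed. *)
Definition rhombus (R : realType) (a b c d : R[i]) : Prop :=
  [/\ uniq [:: a; b; c; d],
      edge_length a b = edge_length b c,
      edge_length b c = edge_length c d &
      edge_length c d = edge_length d a].

(* Main.v *)
(* A rhombus is a parallelogram, so let it be spanned at one vertex by u and v
   of equal squared length N, with 2 <u, v> = M and with determinant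
   D sqrt 3 / 2; here N, M and D are integers and M^2 + 3 D^2 = 4 N^2.
   Area = perimeter squares to 3 D^2 = 64 N, so 3 divides N, and eliminating
   gives 16 M^2 = 3 D^2 (N - 16), in which the 3-adic valuations of the two
   sides have different parities. The area of the convex hull is |det(u, v)|
   because two shears, which preserve the measure of every vertical
   (horizontal) section, turn the parallelogram into a rectangle. *)

Require Import Defs.
From mathcomp Require Import all_boot all_order all_algebra.
From mathcomp Require Import complex.
From mathcomp Require Import all_classical all_reals all_analysis.
From mathcomp Require Import measurable_realfun.
From mathcomp Require Import ring lra zify.

Set Implicit Arguments.
Unset Strict Implicit.
Unset Printing Implicit Defensive.

Import Order.TTheory GRing.Theory Num.Theory.

Local Open Scope classical_set_scope.
Local Open Scope ring_scope.
Local Open Scope complex_scope.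
Local Open Scope convex_scope.

(** * Arithmetic: an unsolvable Diophantine system *)

Lemma rhombus_equable_eqs_unsolvable (M D N : int) : D != 0 ->
  64 * N = 3 * D ^+ 2 -> M ^+ 2 + 3 * D ^+ 2 = 4 * N ^+ 2 -> False.
Proof.
move=> D0 ND MN.
have MDN : 16 * M ^+ 2 = 3 * D ^+ 2 * (N - 16).
  have -> : M ^+ 2 = 4 * N ^+ 2 - 64 * N by rewrite -MN ND; ring.
  by rewrite -ND; ring.
(* [ND] makes 3 divide N, while 16 is 1 modulo 3. *)
have N3 : ~~ (3 %| `|N - 16|)%N by lia.
have D0' : (0 < `|D|)%N by rewrite absz_gt0.
have k0 : (0 < `|N - 16|)%N by case: (`|N - 16|)%N N3.
have MDN' : (16 * `|M| ^ 2 = 3 * `|D| ^ 2 * `|N - 16|)%N.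
  by rewrite -!abszX -[16%N]/`|16|%N -[3%N]/`|3|%N -!abszM MDN.
(* All factors must be nonzero for [logn 3] to be additive, as [logn 3 0] is 0. *)
have M0 : (0 < `|M|)%N.
  by move: MDN'; case: (`|M|)%N => // /esym/eqP; rewrite !muln_eq0; lia.
have := congr1 (logn 3) MDN'.
rewrite !lognM ?muln_gt0 ?expn_gt0 ?D0' ?M0 ?k0//.
rewrite (lognE 3 16) (lognE 3 `|N - 16|) (negbTE N3) !andbF /=.
rewrite (_ : logn 3 3 = 1)%N; last by [].
(* With v for [logn 3], what remains is 2 v(M) = 1 + 2 v(D). *)
lia.
Qed.

(** * Lebesgue measure in the plane: shears and strips *)

Section Area.
Context {R : realType}.
Local Notation RR := (measurableTypeR R).
Local Notation mu := (@lebesgue_measure R).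

(** The pushforward of [mu] by a translation gives half-open intervals their length, and these
    values determine Lebesgue measure. *)
Lemma lebesgue_measure_shift (c : R) (A : set RR) : measurable A ->
  mu [set x : RR | A ((x : R) + c)] = mu A.
Proof.
move=> mA.
have mshift : measurable_fun [set: RR] (fun x : RR => (x : R) + c : RR).
  exact: measurable_funD.
transitivity (pushforward mu (fun x : RR => (x : R) + c : RR) A); first by [].
apply/esym.
apply: (@lebesgue_measure_unique R
  (pushforward mu (fun x : RR => (x : R) + c : RR))) => //.
move=> X [[x y] xy <-].
transitivity (mu [set` `](x - c), (y - c)]]).
  rewrite !lebesgue_measure_itv /= !lte_fin ltrD2r; case: ifP => // _.
  by rewrite -!EFinB; congr EFin; ring.
rewrite /pushforward; congr (mu _).
by apply/seteqP; split=> z /=; rewrite !in_itv/= ltrBlDr lerBrDr.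
Qed.

(** The two orders of iterated integration agree on rectangles, hence define the same measure. *)
Lemma lebesgue2_swap (A : set (RR * RR)) : measurable A ->
  (mu \x mu)%E A = (mu \x mu)%E [set p | A (p.2, p.1)].
Proof.
move=> mA.
rewrite (@product_measure_unique _ _ _ _ _ mu mu (mu \x^ mu)%E)//.
by move=> X Y mX mY; exact: product_measure2E.
Qed.

(** Each vertical section is a translate of the corresponding section of [A], so the integrands
    agree pointwise. *)
Lemma lebesgue2_shear (k : R -> R) (A : set (RR * RR)) : measurable A ->
  (mu \x mu)%E [set p : RR * RR | A (p.1, (p.2 : R) + k p.1 : RR)] =
  (mu \x mu)%E A.
Proof.
move=> mA; apply: eq_integral => x _ /=.
rewrite -(lebesgue_measure_shift (k x) (measurable_xsection x mA)).
by congr (mu _); apply/seteqP; split=> y; rewrite /xsection/= !inE.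
Qed.

Lemma lebesgue_measure_strip (l n : R) : l != 0 ->
  mu [set x : RR | 0 <= l * (x : R) + n <= 1] = (`|l|^-1)%:E.
Proof.
move=> l0; have [l_gt0|l_lt0|] := ltrgt0P l; last first.
  by move=> l00; rewrite l00 eqxx in l0.
- rewrite (_ : [set x : RR | _] = [set` `[((1 - n) / l), (- n / l)]]); last first.
    apply/seteqP; split=> x /=; rewrite in_itv /= ler_ndivrMr // ler_ndivlMr //; lra.
  rewrite lebesgue_measure_itv /= lte_fin ifT; last by rewrite ltr_nM2r ?invr_lt0//; lra.
  by rewrite -EFinB; congr EFin; field.
- rewrite (_ : [set x : RR | _] = [set` `[(- n / l), ((1 - n) / l)]]); last first.
    apply/seteqP; split=> x /=; rewrite in_itv /= ler_pdivrMr // ler_pdivlMr //; lra.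
  rewrite lebesgue_measure_itv /= lte_fin ifT; last by rewrite ltr_pM2r ?invr_gt0//; lra.
  by rewrite -EFinB; congr EFin; field.
Qed.

(** Coordinates along the sides of a parallelogram are affine forms, so the parallelogram is an
    intersection of two strips. *)
Definition strip (l m n : R) : set (RR * RR) :=
  [set p | 0 <= l * (p.1 : R) + m * (p.2 : R) + n <= 1].

Lemma measurable_strip l m n : measurable (strip l m n).
Proof.
have mf : measurable_fun [set: RR * RR]
    (fun p : RR * RR => l * (p.1 : R) + m * (p.2 : R) + n : RR).
  apply: measurable_funD => //; apply: measurable_funD.
    by apply: measurable_funM => //; exact: measurable_fst.
  by apply: measurable_funM => //; exact: measurable_snd.
have := mf measurableT `[0, 1]%classic (measurable_itv _).
rewrite setTI => H; refine (eq_ind _ measurable H _ _).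
by apply/seteqP; split=> p; rewrite /strip /= in_itv.
Qed.

Lemma lebesgue2_strips l1 m1 n1 l2 m2 n2 : l1 * m2 - l2 * m1 != 0 ->
  (mu \x mu)%E (strip l1 m1 n1 `&` strip l2 m2 n2) =
  (`|l1 * m2 - l2 * m1|^-1)%:E.
Proof.
(* If m2 = 0, then l2 is nonzero because the determinant is, and exchanging the coordinates puts l2
   in the place of m2. *)
wlog m20 : l1 m1 l2 m2 / m2 != 0 => [gen d0|].
  have [m20|] := eqVneq m2 0; last by move=> ?; exact: gen.
  have l20 : l2 != 0 by apply: contraNneq d0 => l20; rewrite m20 l20; apply/eqP; ring.
  rewrite distrC [l1 * _]mulrC [l2 * _]mulrC -gen//; last first.
    by rewrite -oppr_eq0 opprB [_ * l1]mulrC [m1 * _]mulrC.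
  rewrite lebesgue2_swap; last by apply: measurableI; exact: measurable_strip.
  by congr (product_measure1 _ _ _); apply/seteqP; split=> -[x y] [h1 h2]; split;
    rewrite /strip /= [X in X + _]addrC.
have mr (r s : R) : measurable [set x : RR | 0 <= r * (x : R) + s <= 1].
  have := (measurable_strip r 0 s).
  move=> /(measurable_ysection (0 : RR))=> H.
  refine (eq_ind _ measurable H _ _).
  by apply/seteqP; split=> x; rewrite /ysection /strip /= inE /= mulr0 addr0.
set d := l1 * m2 - l2 * m1 => d0.
(* In the coordinate y' = y + (l2 x + n2) / m2 the second form becomes m2 y' and the first becomes l
   x + m1 y' + n. *)
pose l := d / m2; pose n := n1 - m1 * n2 / m2.
have l0 : l != 0 by rewrite mulf_neq0 ?invr_neq0.
transitivity ((mu \x mu)%E (strip l m1 n `&` strip 0 m2 0)).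
  rewrite -(@lebesgue2_shear (fun x => (l2 * x + n2) / m2)
    (strip l m1 n `&` _)); last first.
    by apply: measurableI; exact: measurable_strip.
  congr (product_measure1 _ _ _); apply/seteqP; rewrite /strip.
  have E (x y : R) : l * x + m1 * (y + (l2 * x + n2) / m2) + n = l1 * x + m1 * y + n1.
    by rewrite /l /n /d; field.
  have F (x y : R) : 0 * x + m2 * (y + (l2 * x + n2) / m2) + 0 = l2 * x + m2 * y + n2.
    by field.
  by split=> -[x y] /=; rewrite E F.
(* With the coordinates exchanged, a second shear absorbs the m1 term of the first form and leaves a
   product of two intervals. *)
rewrite lebesgue2_swap; last by apply: measurableI; exact: measurable_strip.
transitivity ((mu \x mu)%E ([set x : RR | 0 <= m2 * (x : R) + 0 <= 1] `*`
                           [set x : RR | 0 <= l * (x : R) + n <= 1])).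
  rewrite -(@lebesgue2_shear (fun y => m1 * y / l) (_ `*` _)); last first.
    exact: measurableX.
  congr (product_measure1 _ _ _); apply/seteqP; rewrite /strip.
  have E (x y : R) : l * (y + m1 * x / l) + n = l * y + m1 * x + n by field.
  split=> -[x y] [/=]; rewrite ?E; first by move=> -> h; split=> //; lra.
  by move=> h ->; split=> //; lra.
rewrite product_measure1E//.
transitivity ((`|m2|^-1)%:E * (`|l|^-1)%:E)%E.
  by congr (_ * _)%E; exact: lebesgue_measure_strip.
rewrite -EFinM -invfM -normrM.
by rewrite /l; congr (_^-1%:E); congr (`|_|); field.
Qed.
End Area.

(** * Convex hull and area of a parallelogram *)

Lemma rcomplex_convE (R : realType) (x y : R[i]) (t : {i01 R}) :
  (x : convex_lmodType (Rcomplex R)) <| t |> y =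
  (t%:num * complex.Re x + (1 - t%:num) * complex.Re y) +i*
  (t%:num * complex.Im x + (1 - t%:num) * complex.Im y).
Proof. by case: x y => [x1 x2] [y1 y2]. Qed.

Lemma convex_parallelogramE (R : realType) (a b c d : R[i]) : a + c = b + d ->
  convex_polygon_region [:: a; b; c; d] =
  [set z | exists s t : R, [/\ 0 <= s <= 1, 0 <= t <= 1 &
     z = a + s%:C * (b - a) + t%:C * (d - a)]].
Proof.
move=> abcd; have -> : c = b + d - a by rewrite -abcd [a + c]addrC addrK.
move=> {abcd}.
apply/seteqP; split=> z.
  (* The hull lies in every convex set containing the vertices, so the parametrized set only has to
     be one of these. *)
  apply; split.
    move=> x y l /set_mem[s [t [/andP[s0 s1] /andP[t0 t1] ->]]].
    move=> /set_mem[s' [t' [/andP[s0' s1'] /andP[t0' t1'] ->]]]; apply/mem_set.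
    have l0 : 0 <= l%:num by [].
    have l1 : l%:num <= 1 by [].
    exists (l%:num * s + (1 - l%:num) * s'), (l%:num * t + (1 - l%:num) * t').
    split; [by apply/andP; split; nra..|].
    rewrite rcomplex_convE; case: a b d => [a1 a2] [b1 b2] [d1 d2] /=.
    by apply/eqP; rewrite eq_complex /=; apply/andP; split; apply/eqP; ring.
  have E0 : 0 <= (0 : R) <= 1 by rewrite lexx ler01.
  have E1 : 0 <= (1 : R) <= 1 by rewrite lexx ler01.
  move=> x /=; rewrite !inE => /or4P[] /eqP->.
  - by exists 0, 0; split => //; ring.
  - by exists 1, 0; split => //; ring.
  - by exists 1, 1; split => //; ring.
  - by exists 0, 1; split => //; ring.
move=> [s [t [/andP[s0 s1] /andP[t0 t1] ->]]] M [cM sM].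
have Ma : M a by apply: sM; rewrite /= !inE eqxx.
have Mb : M b by apply: sM; rewrite /= !inE eqxx ?orbT.
have Mc : M (b + d - a) by apply: sM; rewrite /= !inE eqxx ?orbT.
have Md : M d by apply: sM; rewrite /= !inE eqxx ?orbT.
(* Interpolate with weight s along the sides dc and ab, then with weight t between the two points
   obtained. *)
have /set_mem Mz := cM _ _ (Itv01 t0 t1)
  (cM _ _ (Itv01 s0 s1) (mem_set Mc) (mem_set Md))
  (cM _ _ (Itv01 s0 s1) (mem_set Mb) (mem_set Ma)).
refine (eq_ind _ M Mz _ _); rewrite !rcomplex_convE/=.
case: a b d {Ma Mb Mc Md cM sM Mz} => [a1 a2] [b1 b2] [d1 d2] /=.
by apply/eqP; rewrite eq_complex /=; apply/andP; split; apply/eqP; ring.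
Qed.

Lemma planar_area_parallelogram (R : realType) (a b c d : R[i]) :
  a + c = b + d ->
  let u := b - a in let v := d - a in
  let D := complex.Re u * complex.Im v - complex.Im u * complex.Re v in
  D != 0 ->
  planar_area (convex_polygon_region [:: a; b; c; d]) = `|D|%:E.
Proof.
move=> abcd u v D D0; rewrite (convex_parallelogramE abcd) -/u -/v /planar_area.
pose u1 := complex.Re u; pose u2 := complex.Im u.
pose v1 := complex.Re v; pose v2 := complex.Im v.
pose a1 := complex.Re a; pose a2 := complex.Im a.
(* Cramer's rule, solving a + s u + t v = (x, y): the two forms are s and t as functions of x and
   y. *)
transitivity ((lebesgue_measure \x lebesgue_measure)%E
  (strip (v2 / D) (- v1 / D) ((a2 * v1 - a1 * v2) / D) `&`
   strip (- u2 / D) (u1 / D) ((a1 * u2 - a2 * u1) / D))).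
  have zE (s t : R) : a + s%:C * u + t%:C * v =
      (a1 + s * u1 + t * v1) +i* (a2 + s * u2 + t * v2).
    rewrite /u1 /v1 /a1 /u2 /v2 /a2; case: (a) (u) (v) => [? ?] [? ?] [? ?] /=.
    by apply/eqP; rewrite eq_complex /=; apply/andP; split; apply/eqP; ring.
  congr (product_measure1 _ _ _); apply/seteqP; split=> -[x y] /=.
    move=> [s [t [s01 t01]]]; rewrite zE => -[-> ->]; rewrite /strip /=.
    by split; [rewrite (_ : v2 / D * _ + _ + _ = s)|rewrite (_ : _ * _ + _ + _ = t)] => //;
      rewrite /D -/u1 -/v1 -/u2 -/v2; field.
  rewrite /strip /= => -[s01 t01].
  eexists; eexists; split; [exact: s01|exact: t01|].
  by rewrite zE; congr (_ +i* _); rewrite /D -/u1 -/v1 -/u2 -/v2; field.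
(* The linear parts of the forms make up the inverse of the matrix with columns u and v. *)
have DE : v2 / D * (u1 / D) - - u2 / D * (- v1 / D) = D^-1.
  by rewrite /D -/u1 -/v1 -/u2 -/v2; field.
by rewrite lebesgue2_strips DE ?invr_neq0// normfV invrK.
Qed.

(** * Plane geometry: a rhombus is a parallelogram *)

Lemma sqr_edge_length (R : realType) (z w : R[i]) :
  edge_length z w ^+ 2 =
  complex.Re (w - z) ^+ 2 + complex.Im (w - z) ^+ 2.
Proof.
case: z w => [z1 z2] [w1 w2].
by rewrite /edge_length /= sqr_sqrtr// addr_ge0// sqr_ge0.
Qed.

Lemma rhombus_parallelogram (R : realType) (a b c d : R[i]) :
  rhombus a b c d -> a + c = b + d.
Proof.
move=> [abcd_uniq ab bc cd].
have {}ab := congr1 (fun x => x ^+ 2) ab.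
have {}bc := congr1 (fun x => x ^+ 2) bc.
have {}cd := congr1 (fun x => x ^+ 2) cd.
have {abcd_uniq} [ac bd] : a != c /\ b != d.
  by move: abcd_uniq; rewrite /= !inE !negb_or => /and4P[/and3P[_ ->]] _ /andP[_ ->].
move: ac bd ab bc cd; rewrite !sqr_edge_length.
case: a b c d => [a1 a2] [b1 b2] [c1 c2] [d1 d2] /=.
rewrite !eq_complex /= => ac bd ab bc cd.
(* z = b + d - a - c is orthogonal to both diagonals e and w. *)
pose e1 := a1 - c1; pose e2 := a2 - c2; pose w1 := b1 - d1; pose w2 := b2 - d2.
pose z1 := b1 + d1 - (a1 + c1); pose z2 := b2 + d2 - (a2 + c2).
have ze : z1 * e1 + z2 * e2 = 0 by rewrite /z1 /z2 /e1 /e2; lra.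
have zw : z1 * w1 + z2 * w2 = 0 by rewrite /z1 /z2 /w1 /w2; lra.
have ew : e1 * w1 + e2 * w2 = 0 by rewrite /e1 /e2 /w1 /w2; lra.
have sum_sqr_neq0 (x y : R) : ~~ ((x == 0) && (y == 0)) -> x ^+ 2 + y ^+ 2 != 0.
  by rewrite paddr_eq0 ?sqr_ge0// !sqrf_eq0.
(* The diagonals are nonzero and orthogonal, so Lagrange's identity makes their determinant
   nonzero. *)
have dew : e1 * w2 - e2 * w1 != 0.
  rewrite -sqrf_eq0.
  have -> : (e1 * w2 - e2 * w1) ^+ 2 =
      (e1 ^+ 2 + e2 ^+ 2) * (w1 ^+ 2 + w2 ^+ 2) - (e1 * w1 + e2 * w2) ^+ 2 by ring.
  by rewrite ew expr0n subr0 mulf_neq0// sum_sqr_neq0// !subr_eq0.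
have z10 : z1 = 0.
  apply: (mulIf dew); rewrite mul0r.
  transitivity ((z1 * e1 + z2 * e2) * w2 - (z1 * w1 + z2 * w2) * e2); first by ring.
  by rewrite ze zw; ring.
have z20 : z2 = 0.
  apply: (mulIf dew); rewrite mul0r.
  transitivity ((z1 * w1 + z2 * w2) * e1 - (z1 * e1 + z2 * e2) * w1); first by ring.
  by rewrite ze zw; ring.
apply/eqP; rewrite eq_complex /=.
move/eqP: z10; rewrite subr_eq0 => /eqP->.
by move/eqP: z20; rewrite subr_eq0 => /eqP->; rewrite !eqxx.
Qed.

(** * Lattice coordinates and the contradiction *)

Lemma eisensteinB (R : realType) (z w : R[i]) : eisenstein z -> eisenstein w ->
  exists p q : int, z - w = (p%:~R - q%:~R / 2) +i* (q%:~R * (Num.sqrt 3 / 2)).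
Proof.
move=> [z1 [z2 ->]] [w1 [w2 ->]]; exists (z1 - w1), (z2 - w2).
have intC (n : int) : n%:~R = (n%:~R : R)%:C by rewrite rmorph_int.
rewrite !intC !rmorphB /= /omega.
by apply/eqP; rewrite eq_complex /=; apply/andP; split; apply/eqP; field.
Qed.

(** The form is the squared modulus of x + y [omega]; four times it is (2x - y)^2 + 3y^2. *)
Lemma eisenstein_norm_eq0 (x y : int) :
  x ^+ 2 - x * y + y ^+ 2 = 0 -> x = 0 /\ y = 0.
Proof. by move=> xy; split; nia. Qed.

Theorem corollary1 (R : realType) (a b c d : complex R) :
  eisenstein a -> eisenstein b -> eisenstein c -> eisenstein d ->
  rhombus a b c d -> ~ equable [:: a; b; c; d].
Proof.
move=> Ea Eb Ec Ed rh; have abcd := rhombus_parallelogram rh.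
have [abcd_uniq ab bc cd] := rh.
have [p [q uE]] := eisensteinB Eb Ea.
have [r [s vE]] := eisensteinB Ed Ea.
rewrite /equable /perimeter /= !big_cons big_nil /= -cd -bc -ab addr0.
set h := Num.sqrt 3 / 2 in uE vE.
have h2 : h ^+ 2 = 3 / 4 by rewrite /h exprMn sqr_sqrtr//; field.
(* Here u = b - a = p + q [omega] and v = d - a = r + s [omega]; the determinant of u and v is
   [D * h]. *)
pose N : int := p ^+ 2 - p * q + q ^+ 2.
pose M : int := 2 * p * r - p * s - q * r + 2 * q * s.
pose D : int := p * s - q * r.
have LN : edge_length a b ^+ 2 = N%:~R.
  by rewrite sqr_edge_length uE /= exprMn h2 /N
    !(rmorphD, rmorphB, rmorphM, rmorphXn) /=; field.
have LN' : edge_length a b ^+ 2 = (r ^+ 2 - r * s + s ^+ 2)%:~R.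
  have -> : edge_length a b ^+ 2 = edge_length a d ^+ 2.
    rewrite ab bc cd !sqr_edge_length -opprB.
    by case: (d - a) => [x y] /=; rewrite !sqrrN.
  by rewrite sqr_edge_length vE /= exprMn h2
    !(rmorphD, rmorphB, rmorphM, rmorphXn) /=; field.
have NE : N = r ^+ 2 - r * s + s ^+ 2.
  by apply/eqP; rewrite -(eqr_int R) -LN -LN'.
(* Lagrange's identity for u and v, multiplied by 4; one factor N is read as the squared length of
   v. *)
have MDN : M ^+ 2 + 3 * D ^+ 2 = 4 * N ^+ 2.
  by rewrite [N ^+ 2]expr2 {2}NE /M /D /N; ring.
(* |u - v|^2 |u + v|^2 = (2N - M)(2N + M) = 3 D^2, and u - v, u + v are the
   diagonals. *)
have D0 : D != 0.
  apply/eqP => D0.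
  have : (2 * N - M) * (2 * N + M) = 0.
    transitivity (3 * D ^+ 2); last by rewrite D0; ring.
    by rewrite (_ : 3 * D ^+ 2 = 4 * N ^+ 2 - M ^+ 2); [ring|rewrite -MDN; ring].
  move=> /eqP; rewrite mulf_eq0 => /orP[] /eqP NM.
    have [pr qs] : p - r = 0 /\ q - s = 0.
      apply: eisenstein_norm_eq0; rewrite -NM.
      transitivity (N + (r ^+ 2 - r * s + s ^+ 2) - M).
        by rewrite /N /M; ring.
      by rewrite -NE; ring.
    have bd : b = d.
      by apply: (addIr (- a)); rewrite uE vE (subr0_eq pr) (subr0_eq qs).
    by move: abcd_uniq; rewrite bd /= !inE eqxx !orbT andbF.
  have [pr qs] : p + r = 0 /\ q + s = 0.
    apply: eisenstein_norm_eq0; rewrite -NM.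
    transitivity (N + (r ^+ 2 - r * s + s ^+ 2) + M).
      by rewrite /N /M; ring.
    by rewrite -NE; ring.
  have ac : c - a = 0.
    have -> : c - a = (b - a) + (d - a).
      by transitivity (b + d - a - a); [rewrite -abcd; ring|ring].
    rewrite uE vE -(addr0_eq pr) -(addr0_eq qs) !rmorphN /=.
    by apply/eqP; rewrite eq_complex /=; apply/andP; split; apply/eqP; field.
  by move: abcd_uniq; rewrite (subr0_eq ac) /= !inE eqxx !orbT.
have detE : complex.Re (b - a) * complex.Im (d - a) -
            complex.Im (b - a) * complex.Re (d - a) = D%:~R * h.
  by rewrite uE vE /= /D rmorphB !rmorphM /=; field.
have h0 : h != 0 by rewrite -sqrf_eq0 h2 mulf_neq0 ?invr_neq0 ?pnatr_eq0.
rewrite planar_area_parallelogram // detE ?mulf_neq0 ?intr_eq0// => -[areaE].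
apply: (rhombus_equable_eqs_unsolvable D0 _ MDN).
apply/eqP; rewrite -(eqr_int R) !rmorphM /= -LN.
(* Squared, the equation between area and perimeter reads (3/4) D^2 = 16 N. *)
have := congr1 (fun x => x ^+ 2) areaE; rewrite real_normK ?num_real// exprMn h2.
clear; lra.
Qed.
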